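(* The poset of many-one degrees of computably transparent partial multimaps on $\mathbf N$ is isomorphic to the Weihrauch degrees (of partial multimaps on $\mathbf N$).
   Context: Let $(\mathsf N,\mathbf N,\ast)$ be one of: (i) Kleene's first algebra: $\mathsf N=\mathbf N=\mathbb N$, $e\ast n=\varphi_e(n)$ for the standard indexing of partial computable functions on $\mathbb N$; (ii) Kleene's second algebra: $\mathsf N=\mathbf N=\mathbb N^{\mathbb N}$, $x\ast y=\varphi_x(y)$ for the standard indexing $(\varphi_x)_{x\in\mathbb N^{\mathbb N}}$ of partial continuous functions on Baire space; (iii) the Kleene–Vesley algebra: $\mathbf N=\mathbb N^{\mathbb N}$ with $\ast$ as in (ii) and $\mathsf N$ the set of computable elements of $\mathbb N^{\mathbb N}$. Write $\varphi_x(y)=x\ast y$, $x\ast y\ast z=(x\ast y)\ast z$, and $x\ast A=\{x\ast a:a\in A\}$ for $A\subseteq\mathbf N$ (defined iff $x\ast a$ is defined for all $a\in A$). A partial function on $\mathbf N$ is computable if for some $e\in\mathsf N$ it agrees with $\varphi_e$ on its domain. Pairs are coded in $\mathbf N$ by a standard computable pairing. A partial multimap on $\mathbf N$ is a partial function $f$ from $\mathbf N$ to $\mathcal P(\mathbf N)$ (the value $\emptyset$ is allowed and is distinguished from being undefined). Many-one reducibility: $f\leq_m g$ iff there is a computable $\varphi$ such that for all $x\in\mathrm{dom}(f)$, $\varphi(x)$ is defined, $\varphi(x)\in\mathrm{dom}(g)$ and $g(\varphi(x))\subseteq f(x)$. Weihrauch reducibility: $f\leq_W g$ iff there are computable $\varphi_-,\varphi_+$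 such that for all $x\in\mathrm{dom}(f)$, $\varphi_-(x)$ is defined and in $\mathrm{dom}(g)$, and for all $y\in g(\varphi_-(x))$, $\varphi_+(x,y)$ is defined and in $f(x)$. Degrees are equivalence classes of the preorder, with the induced partial order. A partial multimap $U$ is computably transparent if it is nonempty (i.e. $\mathrm{dom}(U)\neq\emptyset$) and there is $u\in\mathsf N$ such that for all $a,x\in\mathbf N$, whenever $a\ast U(x)$ is defined (i.e. $x\in\mathrm{dom}(U)$ and $a\ast y$ is defined for every $y\in U(x)$), $u\ast a\ast x\in\mathrm{dom}(U)$ and $U(u\ast a\ast x)\subseteq a\ast U(x)$.
   Formalization: Nonemptiness is treated alike on both sides: the isomorphism is proved for nonempty transparent multimaps versus Weihrauch degrees of nonempty multimaps, and for transparency without nonemptiness versus all Weihrauch degrees; mixing the conventions is false (Kleene–Vesley). *)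

(* Defs.v *)
From Stdlib Require Cantor.
From mathcomp Require Import all_boot.
From mathcomp Require Import boolp classical_sets.

Set Implicit Arguments.
Unset Strict Implicit.
Unset Printing Implicit Defensive.

Local Open Scope classical_set_scope.

(* Partial recursive functions of one variable. Several arguments are passed
   through the Cantor pairing; with m = 0, n.+1 in turn and writing <_,_> for it,
     PRec p q <a, 0>    = p a,
     PRec p q <a, n.+1> = q <a, <n, PRec p q <a, n>>>,
     PMu p a            = the least m such that p <a, m> = 0, all p <a, j> for
                          j < m being defined. *)

Definition npair (a b : nat) : nat := Cantor.to_nat (a, b).
Definition nfst (n : nat) : nat := (Cantor.of_nat n).1.
Definition nsnd (n : nat) : nat := (Cantor.of_nat n).2.

Inductive prog : Type :=
  | PZero | PSucc | PFst | PSnd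
  | PPair of prog & prog
  | PComp of prog & prog
  | PRec of prog & prog
  | PMu of prog.

(* [sem p n m]: the program p halts on input n with output m. *)
Fixpoint sem (p : prog) (n m : nat) {struct p} : Prop :=
  match p with
  | PZero => m = 0
  | PSucc => m = n.+1
  | PFst => m = nfst n
  | PSnd => m = nsnd n
  | PPair p q => exists a b, [/\ sem p n a, sem q n b & m = npair a b]
  | PComp p q => exists2 k, sem q n k & sem p k m
  | PRec p q =>
      (fix iter (k r : nat) {struct k} : Prop :=
         match k with
         | 0 => sem p (nfst n) r
         | k'.+1 => exists2 r', iter k' r' &
                      sem q (npair (nfst n) (npair k' r')) r
         end) (nsnd n) m
  | PMu p =>
      sem p (npair n m) 0 /\
      forall j, j < m -> exists v, sem p (npair n j) v.+1
  end.

Fixpoint godel (p : prog) : nat :=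
  match p with
  | PZero => npair 0 0
  | PSucc => npair 1 0
  | PFst => npair 2 0
  | PSnd => npair 3 0
  | PPair p q => npair 4 (npair (godel p) (godel q))
  | PComp p q => npair 5 (npair (godel p) (godel q))
  | PRec p q => npair 6 (npair (godel p) (godel q))
  | PMu p => npair 7 (godel p)
  end.

(* Graph of the e-th partial computable function; a number that is not the
   Gödel number of a program indexes the nowhere defined function. *)
Definition phi (e n m : nat) : Prop := exists2 p, godel p = e & sem p n m.

Definition computable_seq (x : nat -> nat) : Prop :=
  exists e, forall n, phi e n (x n).

Fixpoint code_seq (s : seq nat) : nat :=
  if s is a :: s' then (npair a (code_seq s')).+1 else 0.

(* Kleene's indexing of partial continuous functions by associates: the value
   at n of the x-th function on y is v when x answers v.+1 on n followed by
   some initial segment of y, and answers 0 (more input needed) on all shorter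
   ones. The result is defined only if it is a total sequence. *)
Definition assoc_app (x y z : nat -> nat) : Prop :=
  forall n, exists k,
    x (code_seq (n :: mkseq y k)) = (z n).+1 /\
    forall j, j < k -> x (code_seq (n :: mkseq y j)) = 0.

Definition seq_pair (x y : nat -> nat) : nat -> nat :=
  fun n => if odd n then y n./2 else x n./2.

Lemma npair_inj a b a' b' : npair a b = npair a' b' -> a = a' /\ b = b'.
Proof. by move=> /Cantor.to_nat_inj [-> ->]. Qed.

Lemma godel_inj : injective godel.
Proof.
elim=> [||||p IHp q IHq|p IHp q IHq|p IHp q IHq|p IHp]
       [||||p' q'|p' q'|p' q'|p'] /npair_inj [] // _.
- by move=> /npair_inj [/IHp -> /IHq ->].
- by move=> /npair_inj [/IHp -> /IHq ->].
- by move=> /npair_inj [/IHp -> /IHq ->].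
- by move=> /IHp ->.
Qed.

Lemma sem_fun p n m m' : sem p n m -> sem p n m' -> m = m'.
Proof.
elim: p n m m' => [||||p IHp q IHq|p IHp q IHq|p IHp q IHq|p IHp] n m m' /=;
  try by move=> -> ->.
- move=> [a [b [pa qb ->]]] [a' [b' [pa' qb' ->]]].
  by rewrite (IHp _ _ _ pa pa') (IHq _ _ _ qb qb').
- move=> [k qk pk] [k' qk' pk']; rewrite -(IHq _ _ _ qk qk') in pk'.
  exact: IHp pk pk'.
- elim: (nsnd n) m m' => [|k IHk] m m'; first exact: IHp.
  move=> [r rk qr] [r' rk' qr']; rewrite -(IHk _ _ rk rk') in qr'.
  exact: IHq qr qr'.
- move=> [pm lm] [pm' lm']; case: (ltngtP m m') => // lt.
  + by have [v /IHp /(_ pm)] := lm' _ lt.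
  + by have [v /IHp /(_ pm')] := lm _ lt.
Qed.

Lemma phi_fun e n m m' : phi e n m -> phi e n m' -> m = m'.
Proof.
by move=> [p <- pm] [p' /godel_inj -> pm']; exact: sem_fun pm pm'.
Qed.

Lemma assoc_app_fun x y z z' : assoc_app x y z -> assoc_app x y z' -> z = z'.
Proof.
move=> xz xz'; apply: funext => n.
have [k [xk lk]] := xz n; have [k' [xk' lk']] := xz' n.
case: (ltngtP k k') => [lt|lt|kk'].
- by rewrite lk' in xk.
- by rewrite lk in xk'.
- by move: xk'; rewrite -kk' xk => -[].
Qed.

(* [app x y z] is the graph of the partial operation x * y = z. *)
Record appStruct := AppStruct {
  elt :> Type;
  eff : set elt;
  app : elt -> elt -> elt -> Prop;
  app_fun : forall x y z z', app x y z -> app x y z' -> z = z';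
  cpair : elt -> elt -> elt
}.
Arguments eff : clear implicits.

Definition kleene1 : appStruct := AppStruct setT phi_fun npair.
Definition kleene2 : appStruct := AppStruct setT assoc_app_fun seq_pair.
Definition kleene_vesley : appStruct :=
  AppStruct computable_seq assoc_app_fun seq_pair.

Section Multimaps.
Variable A : appStruct.
Implicit Types (a x y z : A).

Definition computable (h : A -> option A) : Prop :=
  exists2 e, eff A e & forall x y, h x = Some y -> app e x y.

(* [None] is "undefined", as opposed to [Some set0]. *)
Definition multimap : Type := A -> option (set A).

Implicit Types f g U : multimap.

Definition mdom f : set A := [set x | isSome (f x)].

(* Only meaningful for x in [mdom f]. *)
Definition mval f x : set A := odflt set0 (f x).

Definition m_reducible f g : Prop :=
  exists2 h, computable h &
    forall x, mdom f x ->
      exists z, [/\ h x = Some z, mdom g z & mval g z `<=` mval f x].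

Definition W_reducible f g : Prop :=
  exists hm hp, [/\ computable hm, computable hp &
    forall x, mdom f x ->
      exists z, [/\ hm x = Some z, mdom g z &
        forall y, mval g z y ->
          exists w, hp (cpair x y) = Some w /\ mval f x w]].

Definition image_defined a U x : Prop :=
  mdom U x /\ forall y, mval U x y -> exists z, app a y z.

Definition app_image a U x : set A :=
  [set z | exists2 y, mval U x y & app a y z].

Definition nonempty_dom U : Prop := mdom U !=set0.

(* The nowhere defined multimap satisfies this law vacuously; it is excluded by
   [computably_transparent] below. Its Weihrauch degree is the least one and
   contains no computably transparent multimap. *)
Definition transparency_law U : Prop :=
  exists2 u, eff A u &
    forall a x, image_defined a U x ->
      exists b c, [/\ app u a b, app b x c, mdom U c &
                      mval U c `<=` app_image a U x].

Definition computably_transparent U : Prop :=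
  nonempty_dom U /\ transparency_law U.

End Multimaps.

Section Degrees.
Variables (T : Type) (leT : T -> T -> Prop).

Definition degree (a : T) : set T := [set b | leT a b /\ leT b a].

(* The degrees of the elements of P. *)
Definition degrees (P : set T) : Type :=
  {D : set T | exists2 a, P a & D = degree a}.

Definition degree_le (P : set T) (D E : degrees P) : Prop :=
  exists a b, [/\ sval D a, sval E b & leT a b].

End Degrees.

Definition order_isomorphic (X Y : Type)
    (leX : X -> X -> Prop) (leY : Y -> Y -> Prop) : Prop :=
  exists2 F : X -> Y, bijective F &
    forall x x', leX x x' <-> leY (F x) (F x').

Definition m_degree_le (A : appStruct) (P : set (multimap A)) :=
  @degree_le (multimap A) (@m_reducible A) P.

Definition W_degree_le (A : appStruct) (P : set (multimap A)) :=
  @degree_le (multimap A) (@W_reducible A) P.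

(* Main.v *)
Require Import Defs.
From mathcomp Require Import all_boot zify.
From mathcomp Require Import boolp classical_sets.

Set Implicit Arguments.
Unset Strict Implicit.
Unset Printing Implicit Defensive.

Local Open Scope classical_set_scope.

(** For a multimap g let hull g be the multimap that takes a pair <w, z> to
    w * g(z): it packages a query z to g with a code w for the processing of the
    answers. A Weihrauch reduction of f to g queries g at a point computed from
    the instance x and then applies an operation that knows x; currying this
    operation, so that x is absorbed into a code, gives a many-one reduction of
    f to hull g, and application undoes this ([W_reducible_hull]). The hull is
    always transparent, because a * (w * g(z)) is the value of hull g at the
    pair of z and a code of the composite of a and w ([hull_transparent]). A
    transparent U can do the processing of the answers itself, so hull U is
    many-one reducible to U ([hull_reducible]). Hence on transparent multimaps
    the two reducibilities coincide, and every g is Weihrauch equivalent to the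
    transparent hull g: taking the Weihrauch degree of U is an isomorphism, with
    inverse g |-> hull g. As hull g has nonempty domain exactly when g has, the
    argument applies with and without the nonemptiness requirement.

    This argument uses an algebra only through the closure properties collected
    in [effective_combinators]: effective elements compute projections, pairing,
    composition, application and currying.

    For Kleene's first algebra all of them but application are operations on
    programs and their Gödel numbers. Application is a universal program, here
    the unbounded search for the halting time of a stack machine whose single
    step is a case distinction on codes ([sem_reach], [universal_prog]).

    For the two algebras on Baire space the required associates are all
    obtained from given effective ones by primitive recursion, so both are
    treated at once for an arbitrary class of sequences closed under primitive
    recursion ([primrec_closed], [effective_baire]): all sequences for the
    second algebra, the computable ones for the Kleene-Vesley algebra. *)

(** * Isomorphisms between posets of degrees *)

Section DegreeIsomorphism.
Variables (T : Type) (leT leS : T -> T -> Prop).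
Hypothesis leT_refl : forall a, leT a a.
Hypothesis leT_trans : forall a b c, leT a b -> leT b c -> leT a c.
Hypothesis leS_refl : forall a, leS a a.
Hypothesis leS_trans : forall a b c, leS a b -> leS b c -> leS a c.

Lemma eq_degree (le : T -> T -> Prop) :
    (forall a b c, le a b -> le b c -> le a c) ->
  forall a b, le a b -> le b a -> degree le a = degree le b.
Proof.
move=> tr a b ab ba; apply/seteqP; split=> c /= [? ?]; split;
  by [exact: tr ba _ | exact: tr ab | exact: tr ab _ | exact: tr ba].
Qed.

Definition degree_of (le : T -> T -> Prop) (P : set T) a (Pa : P a) :
  degrees le P := exist _ (degree le a) (ex_intro2 _ _ a Pa erefl).

Lemma degree_ofP (le : T -> T -> Prop) (P : set T) (D : degrees le P) :
  {a | exists Pa : P a, D = degree_of le Pa}.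
Proof.
case: D => D hD; have [a Pa Da] := cid2 hD; exists a, Pa.
by apply: eq_exist.
Qed.

Lemma degree_of_eq (le : T -> T -> Prop) (P : set T) :
    (forall a, le a a) ->
  forall a b (Pa : P a) (Pb : P b),
    degree_of le Pa = degree_of le Pb -> le a b /\ le b a.
Proof.
move=> rf a b Pa Pb /(congr1 sval) /= ab.
have : degree le b b by split.
by rewrite -ab.
Qed.

Lemma degree_le_of (le : T -> T -> Prop) (P : set T) :
    (forall a, le a a) -> (forall a b c, le a b -> le b c -> le a c) ->
  forall a b (Pa : P a) (Pb : P b),
    degree_le (degree_of le Pa) (degree_of le Pb) <-> le a b.
Proof.
move=> rf tr a b Pa Pb; split=> [[c [d [[ac ca] [bd db] cd]]]|ab].
  exact: tr (tr _ _ _ ac cd) db.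
by exists a, b; split=> //; split; exact: rf.
Qed.

(** The isomorphism is D |-> degree of a, for a in D: on P the two preorders
    agree, and the retraction r provides a representative in P for each
    leS-degree of an element of Q. *)
Lemma degrees_isomorphic (P Q : set T) (r : T -> T) :
    (forall a, P a -> Q a) -> (forall a, Q a -> P (r a)) ->
    (forall a b, P a -> P b -> leT a b <-> leS a b) ->
    (forall a, Q a -> leS a (r a) /\ leS (r a) a) ->
  order_isomorphic (@degree_le T leT P) (@degree_le T leS Q).
Proof.
move=> PQ QP TS equiv_r.
pose repT (D : degrees leT P) := projT1 (degree_ofP D).
have repTP D : exists Pa : P (repT D), D = degree_of leT Pa.
  exact: projT2 (degree_ofP D).
pose repS (D : degrees leS Q) := projT1 (degree_ofP D).
have repSP D : exists Qa : Q (repS D), D = degree_of leS Qa.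
  exact: projT2 (degree_ofP D).
have PrepT D : P (repT D) by case: (repTP D).
have QrepS D : Q (repS D) by case: (repSP D).
pose F D := degree_of leS (PQ _ (PrepT D)).
pose G D := degree_of leT (QP _ (QrepS D)).
have Fle D D' : degree_le D D' <-> degree_le (F D) (F D').
  have [Pa {1}->] := repTP D; have [Pa' {1}->] := repTP D'.
  by rewrite !degree_le_of //; exact: TS.
have eq_of le R (tr : forall a b c, le a b -> le b c -> le a c) a b
    (Ra : R a) (Rb : R b) : le a b -> le b a ->
    degree_of le Ra = degree_of le Rb.
  by move=> ab ba; apply: eq_exist; exact: eq_degree.
have repS_of a (Qa : Q a) :
    leS a (repS (degree_of leS Qa)) /\ leS (repS (degree_of leS Qa)) a.
  by have [Qb] := repSP (degree_of leS Qa); exact: degree_of_eq.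
have repT_of a (Pa : P a) :
    leT a (repT (degree_of leT Pa)) /\ leT (repT (degree_of leT Pa)) a.
  by have [Pb] := repTP (degree_of leT Pa); exact: degree_of_eq.
exists F => //; exists G => D.
- have [Pa {2}->] := repTP D; rewrite /G.
  have [le1 le2] := repS_of _ (PQ _ (PrepT D)).
  have [le3 le4] := equiv_r _ (QrepS (F D)).
  apply: eq_of => //; apply/TS => //; try exact: (QP _ (QrepS _)).
  + exact: leS_trans le4 le2.
  + exact: leS_trans le1 le3.
- have [Qa {2}->] := repSP D; rewrite /F.
  have [le1 le2] := repT_of _ (QP _ (QrepS D)).
  have [le3 le4] := equiv_r _ Qa.
  apply: eq_of => //.
  + by apply: leS_trans le4; apply/TS => //; exact: (QP _ Qa).
  + by apply: leS_trans le3 _; apply/TS => //; exact: (QP _ Qa).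
Qed.

End DegreeIsomorphism.

(** * Realizable relations *)

(** Partial operations are handled as relations, so that their composites can be
    formed without deciding where they are defined. *)
Definition realizable (A : appStruct) (R : A -> A -> Prop) : Prop :=
  exists2 e, eff A e & forall x y, R x y -> app e x y.

Section RelationCombinators.
Variable A : appStruct.
Implicit Types (R S : A -> A -> Prop) (p x y z : A).

Definition fst_rel p x := exists y, p = cpair x y.
Definition snd_rel p y := exists x, p = cpair x y.
Definition app_rel p z := exists x y, p = cpair x y /\ app x y z.
Definition pair_rel R S x p := exists y z, [/\ R x y, S x z & p = cpair y z].
Definition comp_rel R S x z := exists2 y, R x y & S y z.

Lemma fst_relI x y : fst_rel (cpair x y) x. Proof. by exists y. Qed.

Lemma snd_relI x y : snd_rel (cpair x y) y. Proof. by exists x. Qed.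

Lemma app_relI x y z : app x y z -> app_rel (cpair x y) z.
Proof. by exists x, y. Qed.

Lemma pair_relI R S x y z : R x y -> S x z -> pair_rel R S x (cpair y z).
Proof. by exists y, z. Qed.

Lemma comp_relI R S x y z : R x y -> S y z -> comp_rel R S x z.
Proof. by exists y. Qed.

End RelationCombinators.

(** The b of the last field is the s-m-n operation: b x is a code for the
    section at x of the given operation. It is itself effective, whereas b x is
    in general only an element of A. *)
Record effective_combinators (A : appStruct) : Prop := {
  realizable_id : realizable (@eq A);
  realizable_fst : realizable (@fst_rel A);
  realizable_snd : realizable (@snd_rel A);
  realizable_pair : forall R S : A -> A -> Prop,
    realizable R -> realizable S -> realizable (pair_rel R S);
  realizable_comp : forall R S : A -> A -> Prop,
    realizable R -> realizable S -> realizable (comp_rel R S);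
  realizable_app : realizable (@app_rel A);
  realizable_curry : forall R : A -> A -> Prop, realizable R ->
    exists b : A -> A, realizable (fun x y => y = b x) /\
      forall x y z, R (cpair x y) z -> app (b x) y z
}.

(** * The transparent hull *)

Section Hull.
Variables (A : appStruct) (hA : effective_combinators A).
Implicit Types (R S : A -> A -> Prop) (f g h U : multimap A) (w x y z p : A).

(** Application is single-valued and the projections are realizable. *)
Lemma cpair_inj w x y z : cpair w x = cpair y z -> w = y /\ x = z.
Proof.
move=> wxyz; split.
- have [e _ ep] := realizable_fst hA; apply: (@app_fun A e (cpair w x)).
    by apply: ep; exists x.
  by rewrite wxyz; apply: ep; exists z.
- have [e _ ep] := realizable_snd hA; apply: (@app_fun A e (cpair w x)).
    by apply: ep; exists w.
  by rewrite wxyz; apply: ep; exists y.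
Qed.

(** Computable functions are given as functions to an option type; this is the
    largest one that e computes. *)
Definition fun_of e x : option A :=
  if pselect (exists y, app e x y) is left xy then Some (projT1 (cid xy))
  else None.

Lemma fun_ofP e x y : fun_of e x = Some y <-> app e x y.
Proof.
rewrite /fun_of; case: pselect => [xy|nxy]; last first.
  by split=> // exy; case: nxy; exists y.
case: cid => y' /= exy'; split=> [[<-]//|exy].
by rewrite (app_fun exy exy').
Qed.

Lemma computable_fun_of e : eff A e -> computable (fun_of e).
Proof. by move=> ee; exists e => // x y /fun_ofP. Qed.

Lemma realizable_computable (k : A -> option A) :
  computable k -> realizable (fun x y => k x = Some y).
Proof. by case=> e ee ek; exists e. Qed.

Lemma m_reducibleP f g : m_reducible f g <->
  exists2 R, realizable R &
    forall x, mdom f x ->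
      exists z, [/\ R x z, mdom g z & mval g z `<=` mval f x].
Proof.
split=> [[k /realizable_computable rk kP]|[R [e ee eR] RP]].
  by exists (fun x y => k x = Some y).
exists (fun_of e) => [|x /RP[z [/eR exz gz gf]]].
  exact: computable_fun_of.
by exists z; split=> //; exact/fun_ofP.
Qed.

Lemma W_reducibleP f g : W_reducible f g <->
  exists R S, [/\ realizable R, realizable S &
    forall x, mdom f x ->
      exists z, [/\ R x z, mdom g z &
        forall y, mval g z y -> exists2 v, S (cpair x y) v & mval f x v]].
Proof.
split=> [[k [l [rk rl klP]]]|[R [S [[d ed dR] [e ee eS] RSP]]]].
  exists (fun x y => k x = Some y), (fun x y => l x = Some y).
  split; [exact: realizable_computable..|].
  move=> x /klP[z [kxz gz lz]]; exists z; split=> // y /lz[v [? ?]].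
  by exists v.
exists (fun_of d), (fun_of e); split; [exact: computable_fun_of..|].
move=> x /RSP[z [/dR dxz gz ez]]; exists z; split=> //; first exact/fun_ofP.
by move=> y /ez[v /eS ? ?]; exists v; split=> //; exact/fun_ofP.
Qed.

Lemma m_reducible_refl f : m_reducible f f.
Proof.
apply/m_reducibleP; exists eq; first exact: (realizable_id hA).
by move=> x fx; exists x; split.
Qed.

Lemma m_reducible_trans f g h :
  m_reducible f g -> m_reducible g h -> m_reducible f h.
Proof.
move=> /m_reducibleP[R rR RP] /m_reducibleP[S rS SP]; apply/m_reducibleP.
exists (comp_rel R S); first exact: (realizable_comp hA).
move=> x /RP[y [Rxy gy gf]]; have [z [Syz hz hg]] := SP _ gy.
by exists z; split=> //; [exists y|exact: subset_trans gf].
Qed.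

(** The domain requires w to be defined on all of g(z), so that undefined
    processing of an answer never shows up as a smaller value. *)
Definition hull g : multimap A := fun p =>
  if pselect (exists w z, p = cpair w z /\ image_defined w g z) then
    Some [set v | exists w z, p = cpair w z /\ app_image w g z v]
  else None.

Lemma mdom_hull g p :
  mdom (hull g) p <-> exists w z, p = cpair w z /\ image_defined w g z.
Proof. by rewrite /mdom /hull /=; case: pselect. Qed.

Lemma mval_hull g w z :
  image_defined w g z -> mval (hull g) (cpair w z) = app_image w g z.
Proof.
move=> wgz; rewrite /mval /hull; case: pselect => [h|[]] /=; last first.
  by exists w, z.
apply/seteqP; split=> v /=; last by exists w, z.
by case=> [w' [z' [/cpair_inj[-> ->]]]].
Qed.

(** From left to right, the outer reduction S is curried: S <x, y> is computed by
    the code b x applied to y. From right to left, a value <w, z> of the many-one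
    reduction splits into the query z and the code w, and the outer reduction
    recomputes w from x to apply it to y. *)
Lemma W_reducible_hull f g : W_reducible f g <-> m_reducible f (hull g).
Proof.
split.
  move=> /W_reducibleP[R [S [rR rS RSP]]]; apply/m_reducibleP.
  have [b [rb bS]] := realizable_curry hA rS.
  exists (pair_rel (fun x y => y = b x) R); first exact: (realizable_pair hA).
  move=> x /RSP[z [Rxz gz zP]].
  have bgz : image_defined (b x) g z.
    by split=> // y /zP[v /bS ? _]; exists v.
  exists (cpair (b x) z); split; first exact: pair_relI.
    by apply/mdom_hull; exists (b x), z.
  rewrite mval_hull // => v [y /zP[v' /bS bxyv' fv'] bxyv].
  by rewrite (app_fun bxyv bxyv').
move=> /m_reducibleP[R rR RP]; apply/W_reducibleP.
pose S := comp_rel (pair_rel (comp_rel (comp_rel (@fst_rel A) R) (@fst_rel A))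
                             (@snd_rel A)) (@app_rel A).
exists (comp_rel R (@snd_rel A)), S; split.
- exact: realizable_comp (realizable_snd hA).
- apply: realizable_comp (realizable_app hA) => //.
  apply: realizable_pair (realizable_snd hA) => //.
  apply: realizable_comp (realizable_fst hA) => //.
  exact: realizable_comp (realizable_fst hA) rR.
move=> x /RP[p [Rxp /mdom_hull[w [z [pwz wgz]]]]].
move: Rxp; rewrite {p}pwz mval_hull // => Rxp sub_f; exists z; split.
- exact: comp_relI Rxp (snd_relI _ _).
- by case: wgz.
move=> y gzy; have [v wyv] := wgz.2 _ gzy.
exists v; last by apply: sub_f; exists y.
apply: comp_relI (app_relI wyv); apply: pair_relI (snd_relI _ _).
exact: comp_relI (comp_relI (fst_relI _ _) Rxp) (fst_relI _ _).
Qed.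

Lemma m_reducible_to_hull g : m_reducible g (hull g).
Proof.
apply/W_reducible_hull/W_reducibleP; exists eq, (@snd_rel A).
split; [exact: realizable_id|exact: realizable_snd|].
by move=> x gx; exists x; split=> // y gxy; exists y => //; exact: snd_relI.
Qed.

(** Currying the operation that takes <<a, w>, x> to a * (w * x). *)
Lemma realizable_compose : exists c : A -> A,
  realizable (fun p d => d = c p) /\
  forall a w x y z, app w x y -> app a y z -> app (c (cpair a w)) x z.
Proof.
have rfst := realizable_fst hA; have rsnd := realizable_snd hA.
have rapp := realizable_app hA.
pose R := comp_rel
  (pair_rel (comp_rel (@fst_rel A) (@fst_rel A))
            (comp_rel (pair_rel (comp_rel (@fst_rel A) (@snd_rel A))
                                (@snd_rel A)) (@app_rel A))) (@app_rel A).
have rR : realizable R.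
  apply: realizable_comp (rapp) => //; apply: realizable_pair => //.
    exact: realizable_comp.
  apply: realizable_comp (rapp) => //; apply: realizable_pair => //.
  exact: realizable_comp.
have [c [rc cR]] := realizable_curry hA rR; exists c; split=> //.
move=> a w x y z wxy ayz; apply: cR; apply: comp_relI (app_relI ayz).
apply: pair_relI; first exact: comp_relI (fst_relI _ _) (fst_relI _ _).
apply: comp_relI (app_relI wxy); apply: pair_relI (snd_relI _ _).
exact: comp_relI (fst_relI _ _) (snd_relI _ _).
Qed.

(** a * (w * g(z)) is the value of the hull at <c <a, w>, z>, where c <a, w>
    codes the composite of a and w; the required u computes this pair from a
    and <w, z>. *)
Lemma hull_transparent g : transparency_law (hull g).
Proof.
have rfst := realizable_fst hA; have rsnd := realizable_snd hA.
have [c [rc cP]] := realizable_compose.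
(* <a, <w, z>> |-> <c <a, w>, z> *)
pose R := pair_rel
  (comp_rel (pair_rel (@fst_rel A) (comp_rel (@snd_rel A) (@fst_rel A)))
            (fun p d => d = c p))
  (comp_rel (@snd_rel A) (@snd_rel A)).
have rR : realizable R.
  apply: realizable_pair => //; last exact: realizable_comp.
  apply: realizable_comp (rc) => //; apply: realizable_pair => //.
  exact: realizable_comp.
have [b [[u eu ub] bR]] := realizable_curry hA rR.
exists u => // a p /[dup] ap [/mdom_hull[w [z [pwz wgz]]] _].
move: ap; rewrite {p}pwz => -[_]; rewrite mval_hull // => awg.
have cgz : image_defined (c (cpair a w)) g z.
  split=> [|y gzy]; first by case: wgz.
  have [v wyv] := wgz.2 _ gzy.
  by have [|t avt] := awg v; [exists y|exists t; exact: cP avt].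
exists (b a), (cpair (c (cpair a w)) z); split; first exact: ub.
- apply: bR; apply: pair_relI.
    apply: comp_relI (erefl _); apply: pair_relI (fst_relI _ _) _.
    exact: comp_relI (snd_relI _ _) (fst_relI _ _).
  exact: comp_relI (snd_relI _ _) (snd_relI _ _).
- by apply/mdom_hull; exists (c (cpair a w)), z.
rewrite mval_hull // => t [y gzy ct].
have [v wyv] := wgz.2 _ gzy.
have gv : mval (hull g) (cpair w z) v by rewrite mval_hull //; exists y.
have [|s avs] := awg v; first by exists y.
by exists v => //; rewrite (app_fun ct (cP _ _ _ _ _ wyv avs)).
Qed.

(** The transparency law says that U at (u * w) * z refines w * U(z), which is
    the value of hull U at <w, z>. *)
Lemma hull_reducible U : transparency_law U -> m_reducible (hull U) U.
Proof.
case=> u eu uP; apply/m_reducibleP.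
have ru : realizable (app u) by exists u.
pose R := comp_rel (pair_rel (comp_rel (@fst_rel A) (app u)) (@snd_rel A))
                   (@app_rel A).
exists R.
  apply: realizable_comp (realizable_app hA) => //.
  apply: realizable_pair (realizable_snd hA) => //.
  exact: realizable_comp (realizable_fst hA) ru.
move=> p /mdom_hull[w [z [-> wUz]]]; rewrite mval_hull //.
have [b [c [uwb bzc Uc Usub]]] := uP _ _ wUz.
exists c; split=> //; apply: comp_relI (app_relI bzc).
by apply: pair_relI (snd_relI _ _); exact: comp_relI (fst_relI _ _) uwb.
Qed.

Lemma W_reducible_of_m f g : m_reducible f g -> W_reducible f g.
Proof.
by move=> fg; apply/W_reducible_hull/(m_reducible_trans fg)/m_reducible_to_hull.
Qed.

Lemma W_reducible_transparent f U :
  transparency_law U -> W_reducible f U <-> m_reducible f U.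
Proof.
move=> tU; split; last exact: W_reducible_of_m.
by move=> /W_reducible_hull fU; exact: m_reducible_trans (hull_reducible tU).
Qed.

Lemma W_reducible_refl f : W_reducible f f.
Proof. exact/W_reducible_of_m/m_reducible_refl. Qed.

Lemma hull_mono g h : m_reducible g h -> m_reducible (hull g) (hull h).
Proof.
move=> /m_reducibleP[R rR RP]; apply/m_reducibleP.
have rfst := realizable_fst hA; have rsnd := realizable_snd hA.
exists (pair_rel (@fst_rel A) (comp_rel (@snd_rel A) R)).
  by apply: realizable_pair => //; exact: realizable_comp.
move=> p /mdom_hull[w [y [-> wgy]]]; rewrite mval_hull //.
have [z [Ryz hz hg]] := RP _ wgy.1.
have whz : image_defined w h z by split=> // v /hg; exact: wgy.2.
exists (cpair w z); split.
- by apply: pair_relI (fst_relI _ _) _; exact: comp_relI (snd_relI _ _) Ryz.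
- by apply/mdom_hull; exists w, z.
- by rewrite mval_hull // => v [t /hg gt wtv]; exists t.
Qed.

(** The hull is a closure operator for many-one reducibility, so transitivity is
    inherited from many-one reducibility. *)
Lemma W_reducible_trans f g h :
  W_reducible f g -> W_reducible g h -> W_reducible f h.
Proof.
move=> /W_reducible_hull fg /W_reducible_hull gh; apply/W_reducible_hull.
apply: m_reducible_trans fg _; apply: m_reducible_trans (hull_mono gh) _.
exact/hull_reducible/hull_transparent.
Qed.

Lemma W_equiv_hull g : W_reducible g (hull g) /\ W_reducible (hull g) g.
Proof.
split; first exact/W_reducible_of_m/m_reducible_to_hull.
exact/W_reducible_hull/m_reducible_refl.
Qed.

Lemma hull_nonempty g : nonempty_dom g -> nonempty_dom (hull g).
Proof.
case=> x gx; have /m_reducibleP[R _ RP] := m_reducible_to_hull g.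
by have [z [_ hz _]] := RP _ gx; exists z.
Qed.

Lemma transparent_degrees_isomorphic :
  order_isomorphic (@m_degree_le A (@computably_transparent A))
                   (@W_degree_le A (@nonempty_dom A))
  /\ order_isomorphic (@m_degree_le A (@transparency_law A))
                      (@W_degree_le A setT).
Proof.
split; apply: (degrees_isomorphic m_reducible_refl m_reducible_trans
  W_reducible_refl W_reducible_trans (r := hull)) => //.
- by move=> U [].
- by move=> g g0; split; [exact: hull_nonempty|exact: hull_transparent].
- by move=> f U _ [_ tU]; apply: iff_sym; exact: W_reducible_transparent.
- by move=> g _; exact: W_equiv_hull.
- by move=> g _; exact: hull_transparent.
- by move=> f U _ tU; apply: iff_sym; exact: W_reducible_transparent.
- by move=> g _; exact: W_equiv_hull.
Qed.

End Hull.

(** * Classes of functions closed under primitive recursion *)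

Lemma nfst_pair a b : nfst (npair a b) = a.
Proof. by rewrite /nfst /npair Cantor.cancel_of_to. Qed.

Lemma nsnd_pair a b : nsnd (npair a b) = b.
Proof. by rewrite /nsnd /npair Cantor.cancel_of_to. Qed.

Lemma npairK n : npair (nfst n) (nsnd n) = n.
Proof.
by rewrite /nfst /nsnd /npair -surjective_pairing Cantor.cancel_to_of.
Qed.

Lemma leq_npair a b : b <= npair a b.
Proof. by have := Cantor.to_nat_non_decreasing a b; rewrite /npair; lia. Qed.

Definition npairE := (nfst_pair, nsnd_pair).

Opaque npair nfst nsnd.

Definition natrec (b : nat) (s : nat -> nat -> nat) (k : nat) : nat :=
  nat_rect (fun=> nat) b s k.

(** Functions of several variables are represented by functions of a single
    number that codes all of them as nested pairs. *)
Record primrec_closed (E : set (nat -> nat)) : Prop := {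
  pr_zero : E (fun=> 0);
  pr_succ : E succn;
  pr_fst : E nfst;
  pr_snd : E nsnd;
  pr_pair : forall f g, E f -> E g -> E (fun n => npair (f n) (g n));
  pr_comp : forall f g, E f -> E g -> E (fun n => f (g n));
  pr_rec : forall b s, E b -> E s ->
    E (fun n => natrec (b (nfst n))
                  (fun k r => s (npair (nfst n) (npair k r))) (nsnd n))
}.

Lemma primrec_closed_setT : primrec_closed setT.
Proof. by []. Qed.

Lemma computable_seqP f :
  computable_seq f <-> exists p, forall n, sem p n (f n).
Proof.
split=> [[e ef]|[p pf]]; last by exists (godel p) => n; exists p.
have [p pe _] := ef 0; exists p => n; have [q qe qn] := ef n.
by rewrite -pe in qe; rewrite -(godel_inj qe).
Qed.

Lemma primrec_closed_computable : primrec_closed computable_seq.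
Proof.
split;
  try by apply/computable_seqP;
      by [exists PZero|exists PSucc|exists PFst|exists PSnd].
- move=> f g /computable_seqP[p pf] /computable_seqP[q qg].
  by apply/computable_seqP; exists (PPair p q) => n /=; exists (f n), (g n).
- move=> f g /computable_seqP[p pf] /computable_seqP[q qg].
  by apply/computable_seqP; exists (PComp p q) => n /=; exists (g n).
- move=> b s /computable_seqP[p pb] /computable_seqP[q qs].
  apply/computable_seqP; exists (PRec p q) => n /=.
  elim: (nsnd n) => [|k IHk] /=; first by move: (pb (nfst n)).
  by eexists; [exact: IHk|exact: qs].
Qed.

(** The first nonzero value among f 0, ..., f (N - 1), and 0 if there is none.
    This is how an associate is consulted: it answers 0 until it has seen enough
    of its argument. *)
Definition search (f : nat -> nat) (N : nat) : nat :=
  natrec 0 (fun k r => if r == 0 then f k else r) N.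

Lemma search0 f N : (forall k, k < N -> f k = 0) -> search f N = 0.
Proof.
elim: N => //= N IHN f0; rewrite IHN => [|k kN]; first exact: f0.
by apply: f0; exact: ltnW.
Qed.

Lemma searchE f N k :
  k < N -> f k <> 0 -> (forall j, j < k -> f j = 0) -> search f N = f k.
Proof.
move=> kN fk f0; elim: N kN => //= N IHN; rewrite ltnS leq_eqVlt.
case/predU1P => [<-|/IHN ->]; first by rewrite search0.
by case: eqP fk.
Qed.

Lemma eq_search f g N :
  (forall k, k < N -> f k = g k) -> search f N = search g N.
Proof.
elim: N => //= N IHN fg; rewrite IHN ?fg // => k kN; apply: fg; exact: ltnW.
Qed.

(** The length of the longest initial segment of [0, N) on which b holds: the
    counter is incremented only while it points to a number satisfying b. For b
    saying that an entry of a sequence can be computed from the information at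
    hand, it is the length of the prefix that is known. *)
Definition known (b : nat -> bool) (N : nat) : nat :=
  natrec 0 (fun _ r => if b r then r.+1 else r) N.

Lemma known_leq (b : nat -> bool) N : known b N <= N.
Proof. by elim: N => //= N IHN; case: ifP => // _; exact: leqW. Qed.

Lemma knownP (b : nat -> bool) N i : i < known b N -> b i.
Proof.
elim: N => //= N IHN; case: ifP => // bN.
by rewrite ltnS leq_eqVlt => /predU1P[->|/IHN].
Qed.

Lemma leq_known (b : nat -> bool) M N :
  M <= N -> (forall i, i < M -> b i) -> M <= known b N.
Proof.
elim: N M => [|N IHN] M; first by rewrite leqn0 => /eqP ->.
rewrite leq_eqVlt => /predU1P[->|]; last first.
  rewrite ltnS => MN bM; apply: leq_trans (IHN _ MN bM) _ => /=.
  by case: ifP.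
move=> bN /=.
have NN : N <= known b N by apply: IHN => // i iN; apply: bN; exact: ltnW.
have eN : known b N = N by apply/eqP; rewrite eqn_leq known_leq.
by rewrite eN bN.
Qed.

(** A nonempty coded sequence is the successor of a pair; on the code 0 of the
    empty one nsnd and nfst return 0, so that its tail is empty again and the
    default entry is 0. *)
Definition cdrop (i c : nat) : nat := iter i (fun c => nsnd c.-1) c.
Definition cnth (c i : nat) : nat := nfst (cdrop i c).-1.
Definition csize (c : nat) : nat := known (fun i => cdrop i c != 0) c.

Lemma nsnd0 : nsnd 0 = 0. Proof. by []. Qed.

Lemma cdrop_code i s : cdrop i (code_seq s) = code_seq (drop i s).
Proof.
rewrite /cdrop; elim: i s => [|i IHi] s; first by rewrite drop0.
rewrite iterSr; case: s => [|a s] /=; last by rewrite nsnd_pair IHi.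
by rewrite nsnd0 (IHi [::]).
Qed.

Lemma cnth_code s i : cnth (code_seq s) i = nth 0 s i.
Proof.
rewrite /cnth cdrop_code -[i in RHS]addn0 -nth_drop.
by case: (drop i s) => //= a t; rewrite nfst_pair.
Qed.

Lemma size_code s : size s <= code_seq s.
Proof. by elim: s => //= a s /leq_trans; apply; exact: leq_npair. Qed.

Lemma csize_code s : csize (code_seq s) = size s.
Proof.
have b_size i : (cdrop i (code_seq s) != 0) = (i < size s).
  rewrite cdrop_code -subn_gt0 -size_drop.
  by case: (drop i s).
apply/eqP; rewrite eqn_leq leq_known ?size_code // => [|i]; last first.
  by rewrite b_size.
by rewrite andbT leqNgt; apply/negP => /knownP; rewrite b_size ltnn.
Qed.

(** Primitive recursion must build the code from the last entry backwards,
    because the code of a sequence contains that of its tail. *)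
Lemma code_mkseqE f k : code_seq (mkseq f k) =
  natrec 0 (fun i r => (npair (f (k - i.+1)) r).+1) k.
Proof.
suff tail i : i <= k ->
    natrec 0 (fun i r => (npair (f (k - i.+1)) r).+1) i
    = code_seq [seq f j | j <- iota (k - i) i].
  by rewrite tail // subnn.
elim: i => //= i IHi ik; rewrite IHi; last exact: ltnW.
by rewrite subnSK.
Qed.

Section PrimrecClosure.
Variables (E : set (nat -> nat)) (hE : primrec_closed E).
Implicit Types f g h : nat -> nat.

Lemma pr_fst_of f : E f -> E (fun n => nfst (f n)).
Proof. by move=> ?; apply: (pr_comp hE (pr_fst hE)). Qed.

Lemma pr_snd_of f : E f -> E (fun n => nsnd (f n)).
Proof. by move=> ?; apply: (pr_comp hE (pr_snd hE)). Qed.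

Lemma pr_succ_of f : E f -> E (fun n => (f n).+1).
Proof. by move=> ?; apply: (pr_comp hE (pr_succ hE)). Qed.

Lemma pr_id : E (fun n => n).
Proof.
rewrite (_ : (fun n => n) = fun n => npair (nfst n) (nsnd n)).
  exact: pr_pair (pr_fst hE) (pr_snd hE).
by apply: funext => n; rewrite npairK.
Qed.

Lemma pr_const c : E (fun=> c).
Proof. by elim: c => [|c]; [exact: pr_zero|exact: pr_succ_of]. Qed.

Lemma pr_natrec (b c : nat -> nat) (s : nat -> nat -> nat -> nat) :
  E b -> E (fun p => s (nfst p) (nfst (nsnd p)) (nsnd (nsnd p))) -> E c ->
  E (fun n => natrec (b n) (s n) (c n)).
Proof.
move=> Eb Es Ec.
have := pr_comp hE (pr_rec hE Eb Es) (pr_pair hE pr_id Ec).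
congr E; apply: funext => n; rewrite !npairE; congr (natrec _ _ _).
by apply/funext => k; apply/funext => r; rewrite !npairE.
Qed.

Lemma pr_iter (F : nat -> nat -> nat) (b c : nat -> nat) :
  E (fun p => F (nfst p) (nsnd p)) -> E b -> E c ->
  E (fun n => iter (c n) (F n) (b n)).
Proof.
move=> EF Eb Ec.
have -> : (fun n => iter (c n) (F n) (b n)) =
          fun n => natrec (b n) (fun _ r => F n r) (c n).
  by apply: funext => n; elim: (c n) => //= k ->.
apply: pr_natrec => //.
have Epair := pr_pair hE (pr_fst hE) (pr_snd_of (pr_snd hE)).
by have := pr_comp hE EF Epair; congr E; apply: funext => p; rewrite !npairE.
Qed.

Lemma pr_pred f : E f -> E (fun n => (f n).-1).
Proof.
have Ep : E predn.
  rewrite (_ : predn = fun n => natrec 0 (fun k _ => k) n).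
    apply: pr_natrec pr_id; first exact: pr_zero.
    exact: (pr_fst_of (pr_snd hE)).
  by apply: funext; case.
by move=> Ef; apply: (pr_comp hE Ep Ef).
Qed.

Lemma pr_add f g : E f -> E g -> E (fun n => f n + g n).
Proof.
move=> Ef Eg; rewrite (_ : (fun n => _) =
    fun n => natrec (g n) (fun _ r => r.+1) (f n)).
  by apply: pr_natrec => //; exact: (pr_succ_of (pr_snd_of (pr_snd hE))).
by apply: funext => n; elim: (f n) => //= k <-.
Qed.

Lemma pr_sub f g : E f -> E g -> E (fun n => f n - g n).
Proof.
move=> Ef Eg; rewrite (_ : (fun n => _) =
    fun n => natrec (f n) (fun _ r => r.-1) (g n)).
  by apply: pr_natrec => //; exact: (pr_pred (pr_snd_of (pr_snd hE))).
by apply: funext => n; elim: (g n) => [|k IHk] /=; rewrite ?subn0 // subnS IHk.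
Qed.

Definition pr_bool (b : nat -> bool) := E (fun n => nat_of_bool (b n)).

Lemma pr_if b f g :
  pr_bool b -> E f -> E g -> E (fun n => if b n then f n else g n).
Proof.
move=> Eb Ef Eg; rewrite (_ : (fun n => _) =
    fun n => natrec (g n) (fun _ _ => f n) (b n)).
  apply: pr_natrec => //; exact: (pr_comp hE Ef (pr_fst hE)).
by apply: funext => n; case: (b n).
Qed.

Lemma pr_eq0 f : E f -> pr_bool (fun n => f n == 0).
Proof.
move=> Ef; rewrite /pr_bool (_ : (fun n => _) =
    fun n => natrec 1 (fun _ _ => 0) (f n)).
  apply: pr_natrec => //; exact: pr_const.
by apply: funext => n; case: (f n).
Qed.

Lemma pr_negb b : pr_bool b -> pr_bool (fun n => ~~ b n).
Proof.
move=> /pr_eq0; rewrite /pr_bool; congr E; apply: funext => n.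
by case: (b n).
Qed.

Lemma pr_leq f g : E f -> E g -> pr_bool (fun n => f n <= g n).
Proof. by move=> Ef Eg; apply: pr_eq0; exact: pr_sub. Qed.

Lemma pr_eq f g : E f -> E g -> pr_bool (fun n => f n == g n).
Proof.
move=> Ef Eg; have := pr_eq0 (pr_add (pr_sub Ef Eg) (pr_sub Eg Ef)).
rewrite /pr_bool; congr E; apply: funext => n; congr nat_of_bool.
by rewrite addn_eq0 !subn_eq0 -eqn_leq.
Qed.

Lemma pr_odd f : E f -> pr_bool (fun n => odd (f n)).
Proof.
move=> Ef; rewrite /pr_bool (_ : (fun n => _) =
    fun n => natrec 0 (fun _ r => (r == 0) : nat) (f n)).
  by apply: pr_natrec => //; [exact: pr_zero|
    exact: (pr_eq0 (pr_snd_of (pr_snd hE)))].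
by apply: funext => n; elim: (f n) => //= k <-; case: (odd k).
Qed.

Lemma pr_double f : E f -> E (fun n => (f n).*2).
Proof.
move=> Ef; have := pr_add Ef Ef; congr E.
by apply: funext => n; rewrite addnn.
Qed.

Lemma pr_half f : E f -> E (fun n => (f n)./2).
Proof.
move=> Ef; rewrite (_ : (fun n => _) =
    fun n => natrec 0 (fun k r => odd k + r) (f n)).
  apply: pr_natrec => //; first exact: pr_zero.
  apply: pr_add; last exact: (pr_snd_of (pr_snd hE)).
  exact: (pr_odd (pr_fst_of (pr_snd hE))).
by apply: funext => n; elim: (f n) => //= k <-; rewrite uphalf_half.
Qed.

Lemma pr_search F N : E (fun p => F (nfst p) (nsnd p)) -> E N ->
  E (fun n => search (F n) (N n)).
Proof.
move=> EF EN; apply: pr_natrec => //; first exact: pr_zero.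
have Epair := pr_pair hE (pr_fst hE) (pr_fst_of (pr_snd hE)).
have Er := pr_snd_of (pr_snd hE).
apply: pr_if => //; first exact: (pr_eq0 Er).
by have := pr_comp hE EF Epair; congr E; apply: funext => p; rewrite !npairE.
Qed.

Lemma pr_known (b : nat -> nat -> bool) N :
  pr_bool (fun p => b (nfst p) (nsnd p)) -> E N ->
  E (fun n => known (b n) (N n)).
Proof.
move=> Eb EN; apply: pr_natrec => //; first exact: pr_zero.
have Epair := pr_pair hE (pr_fst hE) (pr_snd_of (pr_snd hE)).
have Er := pr_snd_of (pr_snd hE).
apply: pr_if => //; last exact: pr_succ_of.
have := pr_comp hE Eb Epair; rewrite /pr_bool; congr E.
by apply: funext => p; rewrite !npairE.
Qed.

Lemma pr_cdrop f g : E f -> E g -> E (fun n => cdrop (f n) (g n)).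
Proof.
by move=> Ef Eg; apply: pr_iter => //; exact: (pr_snd_of (pr_pred (pr_snd hE))).
Qed.

Lemma pr_cnth f g : E f -> E g -> E (fun n => cnth (f n) (g n)).
Proof. by move=> Ef Eg; apply: pr_fst_of; apply: pr_pred; exact: pr_cdrop. Qed.

Lemma pr_csize f : E f -> E (fun n => csize (f n)).
Proof.
move=> Ef; apply: pr_known => //; apply: pr_negb; apply: pr_eq0; apply: pr_cdrop.
  exact: (pr_snd hE).
exact: (pr_comp hE Ef (pr_fst hE)).
Qed.

Lemma pr_mkseq F N : E (fun p => F (nfst p) (nsnd p)) -> E N ->
  E (fun n => code_seq (mkseq (F n) (N n))).
Proof.
move=> EF EN; rewrite (_ : (fun n => _) = fun n =>
    natrec 0 (fun i r => (npair (F n (N n - i.+1)) r).+1) (N n)).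
  apply: pr_natrec => //; first exact: pr_zero.
  apply: pr_succ_of; apply: (pr_pair hE); last exact: (pr_snd_of (pr_snd hE)).
  have EN1 := pr_comp hE EN (pr_fst hE).
  have Ei := pr_succ_of (pr_fst_of (pr_snd hE)).
  have := pr_comp hE EF (pr_pair hE (pr_fst hE) (pr_sub EN1 Ei)).
  by congr E; apply: funext => p; rewrite !npairE.
by apply: funext => n; exact: code_mkseqE.
Qed.

End PrimrecClosure.

(** Proves that a class closed under primitive recursion contains an explicitly
    given function, by recursion on its defining expression. *)
Ltac primrec_step hE :=
  cbv beta;
  lazymatch goal with
  | |- pr_bool _ (fun n => ~~ @?b n) => apply: (@pr_negb _ hE b)
  | |- pr_bool _ (fun n => @?f n == 0) => apply: (@pr_eq0 _ hE f)
  | |- pr_bool _ (fun n => @?f n == @?g n) => apply: (@pr_eq _ hE f g)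
  | |- pr_bool _ (fun n => @?f n <= @?g n) => apply: (@pr_leq _ hE f g)
  | |- pr_bool _ (fun n => odd (@?f n)) => apply: (@pr_odd _ hE f)
  | |- _ (fun n => n) => exact: (pr_id hE)
  | |- _ (fun=> ?c) => exact: (pr_const hE c)
  | |- _ (fun n => npair (@?f n) (@?g n)) => apply: (@pr_pair _ hE f g)
  | |- _ (fun n => nfst (@?f n)) => apply: (@pr_fst_of _ hE f)
  | |- _ (fun n => nsnd (@?f n)) => apply: (@pr_snd_of _ hE f)
  | |- _ (fun n => (@?f n).+1) => apply: (@pr_succ_of _ hE f)
  | |- _ (fun n => (@?f n).-1) => apply: (@pr_pred _ hE f)
  | |- _ (fun n => (@?f n).*2) => apply: (@pr_double _ hE f)
  | |- _ (fun n => (@?f n)./2) => apply: (@pr_half _ hE f)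
  | |- _ (fun n => natrec (@?b n) (@?s n) (@?c n)) =>
      apply: (@pr_natrec _ hE b c s)
  | |- _ (fun n => iter (@?c n) (@?s n) (@?b n)) =>
      apply: (@pr_iter _ hE s b c)
  | |- _ (fun n => search (@?s n) (@?c n)) => apply: (@pr_search _ hE s c)
  | |- _ (fun n => known (@?b n) (@?c n)) => apply: (@pr_known _ hE b c)
  | |- _ (fun n => cnth (@?f n) (@?g n)) => apply: (@pr_cnth _ hE f g)
  | |- _ (fun n => csize (@?f n)) => apply: (@pr_csize _ hE f)
  | |- _ (fun n => code_seq (mkseq (@?s n) (@?c n))) =>
      apply: (@pr_mkseq _ hE s c)
  | He : ?E ?e |- ?E (fun n => ?e (@?f n)) => apply: (@pr_comp _ hE e f He)
  | |- _ => apply: (pr_if hE)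
  end.
Ltac primrec hE := repeat primrec_step hE.

(** * Kleene's first algebra *)

(** A state of the machine is either Ev p n K, evaluate the program with code p
    on n and then continue with the stack K, or Rt v K, return v to K. The
    stack 0 is empty; an entry (t, q, x) is of one of these kinds:
      t = 0   the first component of a pair has been requested, evaluate q on x;
      t = 1   evaluate q on the value returned;
      t = 2   a recursion has been unfolded, evaluate q for x = <a, k>;
      t = 3   a search in q, x = <n, j>, awaits the value at j;
      t = 4   pair q, a first component, with the value returned. *)
Definition Ev (p n K : nat) : nat := npair 0 (npair p (npair n K)).
Definition Rt (v K : nat) : nat := npair 1 (npair v K).
Definition push (t q x K : nat) : nat := (npair (npair t (npair q x)) K).+1.

Definition eval_step (p n K : nat) : nat :=
  let t := nfst p in let q := nfst (nsnd p) in let r := nsnd (nsnd p) in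
  if t == 0 then Rt 0 K
  else if t == 1 then Rt n.+1 K
  else if t == 2 then Rt (nfst n) K
  else if t == 3 then Rt (nsnd n) K
  else if t == 4 then Ev q n (push 0 r n K)
  else if t == 5 then Ev r n (push 1 q 0 K)
  else if t == 6 then
    if nsnd n == 0 then Ev q (nfst n) K
    else let n' := npair (nfst n) (nsnd n).-1 in Ev p n' (push 2 r n' K)
  else Ev (nsnd p) (npair n 0) (push 3 (nsnd p) (npair n 0) K).

Definition return_step (v t q x K : nat) : nat :=
  if t == 0 then Ev q x (push 4 v 0 K)
  else if t == 1 then Ev q v K
  else if t == 2 then Ev q (npair (nfst x) (npair (nsnd x) v)) K
  else if t == 3 then
    if v == 0 then Rt (nsnd x) K
    else let x' := npair (nfst x) (nsnd x).+1 in Ev q x' (push 3 q x' K)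
  else Rt (npair q v) K.

Definition step (s : nat) : nat :=
  let d := nsnd s in
  if nfst s == 0 then eval_step (nfst d) (nfst (nsnd d)) (nsnd (nsnd d))
  else if nsnd d == 0 then s
  else let fr := nfst (nsnd d).-1 in
       return_step (nfst d) (nfst fr) (nfst (nsnd fr)) (nsnd (nsnd fr))
                   (nsnd (nsnd d).-1).

Definition halted (s : nat) : bool := (nfst s != 0) && (nsnd (nsnd s) == 0).

Lemma step_Ev p n K : step (Ev p n K) = eval_step p n K.
Proof. by rewrite /step /Ev !npairE. Qed.

Lemma step_Rt v t q x K : step (Rt v (push t q x K)) = return_step v t q x K.
Proof. by rewrite /step /Rt /push !npairE. Qed.

Definition reach (s s' : nat) : Prop := exists t, iter t step s = s'.

Lemma reach_refl s : reach s s. Proof. by exists 0. Qed.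

Lemma reach_trans s s' s'' : reach s s' -> reach s' s'' -> reach s s''.
Proof. by move=> [t <-] [t' <-]; exists (t' + t); rewrite iterD. Qed.

Lemma reach_step s s' : reach (step s) s' -> reach s s'.
Proof. by move=> [t <-]; exists t.+1; rewrite iterSr. Qed.

(** The stack K is arbitrary so that the induction on programs applies to
    subprograms evaluated on top of new stack entries. *)
Lemma sem_reach p n m K : sem p n m -> reach (Ev (godel p) n K) (Rt m K).
Proof.
elim: p n m K => [||||p IHp q IHq|p IHp q IHq|p IHp q IHq|p IHp] n m K.
1-4: by move=> ->; apply: reach_step; rewrite step_Ev /eval_step /= !npairE /=;
  exact: reach_refl.
- move=> [a [b [pa qb ->]]].
  apply: reach_step; rewrite step_Ev /eval_step /= !npairE /=.
  apply: reach_trans (IHp _ _ _ pa) _.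
  apply: reach_step; rewrite step_Rt /return_step /=.
  apply: reach_trans (IHq _ _ _ qb) _.
  by apply: reach_step; rewrite step_Rt; exact: reach_refl.
- move=> [k qk pk].
  apply: reach_step; rewrite step_Ev /eval_step /= !npairE /=.
  apply: reach_trans (IHq _ _ _ qk) _.
  apply: reach_step; rewrite step_Rt /return_step /=.
  exact: IHp.
- rewrite -{2}(npairK n) /=.
  elim: (nsnd n) m K => [|k IHk] m K.
    move=> pm; apply: reach_step; rewrite step_Ev /eval_step /= !npairE /=.
    exact: IHp.
  move=> [r rk qr]; apply: reach_step; rewrite step_Ev /eval_step /= !npairE /=.
  apply: reach_trans (IHk _ _ rk) _.
  apply: reach_step; rewrite step_Rt /return_step /= !npairE.
  exact: IHq.
- move=> [pm lt_m]; apply: reach_step; rewrite step_Ev /eval_step /= !npairE /=.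
  pose loop j := Ev (godel p) (npair n j) (push 3 (godel p) (npair n j) K).
  have loopP j : j <= m -> reach (loop 0) (loop j).
    elim: j => [_|j IHj jm]; first exact: reach_refl.
    apply: reach_trans (IHj (ltnW jm)) _.
    have [v pv] := lt_m _ jm; apply: reach_trans (IHp _ _ _ pv) _.
    apply: reach_step; rewrite step_Rt /return_step /= !npairE.
    exact: reach_refl.
  apply: reach_trans (loopP _ (leqnn m)) _.
  apply: reach_trans (IHp _ _ _ pm) _.
  apply: reach_step; rewrite step_Rt /return_step /= !npairE.
  exact: reach_refl.
Qed.

Lemma iter_halted s t : halted s -> iter t step s = s.
Proof.
move=> /andP[s0 s1]; elim: t => //= t ->.
by rewrite /step (negbTE s0) s1.
Qed.

Lemma pr_step E : primrec_closed E -> E step.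
Proof.
move=> hE; rewrite (_ : step = fun s => step s) //.
rewrite /step /eval_step /return_step /Ev /Rt /push; cbv zeta; primrec hE.
Qed.

(** Search for a time t at which the machine started on <p, n> has halted, and
    read off the result. Halted states are fixed by the machine, so any such time
    gives the state reached by [sem_reach]. *)
Lemma universal_prog : exists U, forall p n m, sem p n m ->
  sem U (npair (godel p) n) m.
Proof.
have hE := primrec_closed_computable; have Estep := pr_step hE.
pose run x t := iter t step (Ev (nfst x) (nsnd x) 0).
pose running x := if nfst (run (nfst x) (nsnd x)) == 0 then 1
  else if nsnd (nsnd (run (nfst x) (nsnd x))) == 0 then 0 else 1.
have runningE x t : running (npair x t) = ~~ halted (run x t).
  by rewrite /running /halted !npairE; case: eqP => //= _; case: eqP.
have Erunning : computable_seq running.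
  by rewrite (_ : running = fun x => running x) // /running /run /Ev; primrec hE.
have Eresult : computable_seq (fun x => nfst (nsnd (run (nfst x) (nsnd x)))).
  by rewrite /run /Ev; primrec hE.
case/computable_seqP: Erunning => h hP.
case/computable_seqP: Eresult => r rP.
exists (PComp r (PPair (PPair PFst PSnd) (PMu h))) => p n m pm.
have [t tP] := sem_reach 0 pm.
pose x := npair (godel p) n.
have run_t : run x t = Rt m 0 by rewrite /run /x !npairE.
have ht : halted (run x t) by rewrite run_t /halted /Rt !npairE.
have ex_t : exists t, halted (run x t) by exists t.
case: (ex_minnP ex_t) => t0 ht0 min_t0.
have run_t0 : run x t0 = Rt m 0.
  rewrite -run_t -(subnK (min_t0 _ ht)) /run iterD -/(run x t0).
  by rewrite iter_halted.
exists (npair x t0); last first.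
  by have := rP (npair x t0); rewrite !npairE run_t0 /Rt !npairE.
exists x, t0; split=> //; first by exists (nfst x), (nsnd x); rewrite npairK.
split=> [|j jt0].
  by have := hP (npair x t0); rewrite runningE ht0.
exists 0; have := hP (npair x j); rewrite runningE.
by case hj: (halted (run x j)) => //; have := min_t0 _ hj; rewrite leqNgt jt0.
Qed.

Fixpoint prog_const (k : nat) : prog :=
  if k is k'.+1 then PComp PSucc (prog_const k') else PZero.

Lemma sem_const k n : sem (prog_const k) n k.
Proof. by elim: k => //= k IHk; exists k. Qed.

Lemma godel_const k : godel (prog_const k) =
  natrec (npair 0 0) (fun _ c => npair 5 (npair (npair 1 0) c)) k.
Proof. by elim: k => //= k ->. Qed.

(** Currying composes a program with the program that prepends the constant x to
    its input; the Gödel number of the latter is primitive recursive in x. *)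
Lemma effective_kleene1 : effective_combinators kleene1.
Proof.
have hE := primrec_closed_computable.
have sem_id n : sem (PPair PFst PSnd) n n.
  by exists (nfst n), (nsnd n); rewrite npairK.
have realizable_prog (R : kleene1 -> kleene1 -> Prop) p :
    (forall x y, R x y -> sem p x y) -> realizable R.
  by move=> Rp; exists (godel p) => // x y /Rp ?; exists p.
split.
- by apply: (realizable_prog _ (PPair PFst PSnd)) => x _ <-.
- by apply: (realizable_prog _ PFst) => p x [y ->] /=; rewrite nfst_pair.
- by apply: (realizable_prog _ PSnd) => p y [x ->] /=; rewrite nsnd_pair.
- move=> R S [d _ dR] [e _ eS]; exists (npair 4 (npair d e)) => // x w.
  move=> [y [z [/dR[p <- py] /eS[q <- qz] ->]]].
  by exists (PPair p q) => //; exists y, z.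
- move=> R S [d _ dR] [e _ eS]; exists (npair 5 (npair e d)) => // x z.
  move=> [y /dR[p <- py] /eS[q <- qz]].
  by exists (PComp q p) => //; exists y.
- have [U UP] := universal_prog.
  by apply: (realizable_prog _ U) => w z [x [n [-> [p <- /UP]]]].
- move=> R [e _ eR].
  pose b x := npair 5 (npair e (npair 4
    (npair (godel (prog_const x)) (godel (PPair PFst PSnd))))).
  exists b; split.
    have /computable_seqP[p pb] : computable_seq b.
      rewrite /b (_ : (fun x => _) = fun x => npair 5 (npair e (npair 4
        (npair (natrec (npair 0 0) (fun _ c => npair 5 (npair (npair 1 0) c)) x)
          (godel (PPair PFst PSnd)))))); first by primrec hE.
      by apply: funext => x; rewrite godel_const.
    by apply: (realizable_prog _ p) => x _ ->.
  move=> x y z /eR[p pe pz].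
  exists (PComp p (PPair (prog_const x) (PPair PFst PSnd))).
    by rewrite /b -pe.
  by exists (npair x y) => //; exists x, y; split=> //; exact: sem_const.
Qed.

(** * Kleene's second algebra and the Kleene-Vesley algebra *)

Section Baire.
Variables (E : set (nat -> nat)) (hE : primrec_closed E).
Implicit Types (e x y z : nat -> nat).

Definition baire : appStruct := AppStruct E assoc_app_fun seq_pair.

(** An associate may keep changing between 0 and the right answer as its input
    grows: only its first nonzero answer counts. *)
Lemma assoc_appI e y z :
  (forall n k, e (code_seq (n :: mkseq y k)) <> 0 ->
     e (code_seq (n :: mkseq y k)) = (z n).+1) ->
  (forall n, exists k, e (code_seq (n :: mkseq y k)) <> 0) ->
  assoc_app e y z.
Proof.
move=> ez e_def n.
have ex_k : exists k, e (code_seq (n :: mkseq y k)) != 0.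
  by have [k /eqP ek] := e_def n; exists k.
case: (ex_minnP ex_k) => k /eqP ek min_k; exists k; split; first exact: ez.
move=> j jk; apply/eqP; apply: contraTT jk => /min_k.
by rewrite -leqNgt.
Qed.

(** The answer that e gives at n when it may only see prefixes of y of length
    less than N. *)
Definition answer e n y N := search (fun j => e (code_seq (n :: mkseq y j))) N.

Lemma eq_answer e n x y N :
  (forall i, i < N -> x i = y i) -> answer e n x N = answer e n y N.
Proof.
move=> xy; apply: eq_search => k kN; congr (e (code_seq (n :: _))).
apply/eq_in_map => i; rewrite mem_iota add0n => /andP[_ ik].
by apply: xy; exact: ltn_trans kN.
Qed.

Lemma answer_val e y z n N : assoc_app e y z ->
  answer e n y N <> 0 -> answer e n y N = (z n).+1.
Proof.
move=> /(_ n)[k [ek e0]] a0; case: (ltnP k N) => [kN|Nk].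
  by rewrite /answer (searchE kN) ?ek.
by case: a0; apply: search0 => j jN; apply: e0; exact: leq_trans Nk.
Qed.

Lemma answer_def e y z n : assoc_app e y z ->
  exists k, forall N, k <= N -> answer e n y N = (z n).+1.
Proof.
move=> /(_ n)[k [ek e0]]; exists k.+1 => N kN.
by rewrite /answer (searchE kN) ?ek.
Qed.

Lemma seq_pair_even x y i : seq_pair x y i.*2 = x i.
Proof. by rewrite /seq_pair odd_double doubleK. Qed.

Lemma seq_pair_odd x y i : seq_pair x y i.*2.+1 = y i.
Proof. by rewrite /seq_pair /= odd_double uphalf_double. Qed.

Lemma cnth_mkseq y k i : i < k -> cnth (code_seq (mkseq y k)) i = y i.
Proof. by move=> ik; rewrite cnth_code nth_mkseq. Qed.

Lemma csize_mkseq y k : csize (code_seq (mkseq y k)) = k.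
Proof. by rewrite csize_code size_mkseq. Qed.

(** The associate which, after reading the sequence with code c, reacts to the
    question n by body n c. *)
Definition associate (body : nat -> nat -> nat) (c : nat) : nat :=
  body (nfst c.-1) (nsnd c.-1).

Lemma associate_cons body n s :
  associate body (code_seq (n :: s)) = body n (code_seq s).
Proof. by rewrite /associate /= !npairE. Qed.

Lemma associate_app body y z :
  (forall n k, body n (code_seq (mkseq y k)) <> 0 ->
     body n (code_seq (mkseq y k)) = (z n).+1) ->
  (forall n, exists k, body n (code_seq (mkseq y k)) <> 0) ->
  assoc_app (associate body) y z.
Proof.
move=> bz b_def; apply: assoc_appI => n.
  by move=> k; rewrite associate_cons; exact: bz.
by have [k bk] := b_def n; exists k; rewrite associate_cons.
Qed.

Lemma realizable_reindex (r : nat -> nat) : E r ->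
  realizable (A := baire) (fun x y => y = x \o r).
Proof.
move=> Er.
pose body n c := if (r n).+1 <= csize c then (cnth c (r n)).+1 else 0.
exists (associate body).
  by rewrite /= /associate /body; primrec hE.
move=> x _ -> /=; apply: associate_app => n.
  move=> k; rewrite /body csize_mkseq; case: ifP => // rk _.
  by rewrite cnth_mkseq.
by exists (r n).+1; rewrite /body csize_mkseq leqnn.
Qed.

Lemma realizable_seq_pair (R S : baire -> baire -> Prop) :
  realizable R -> realizable S -> realizable (pair_rel R S).
Proof.
move=> [d Ed dR] [e Ee eS].
exists (associate (fun n c => if odd n then e (npair n./2 c).+1
                              else d (npair n./2 c).+1)).
  by move: Ed Ee; rewrite /= /associate => Ed Ee; primrec hE.
move=> x p [y [z [/dR xy /eS xz ->]]] n.
have [j [dj dj0]] := xy n./2; have [k [ek ek0]] := xz n./2.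
rewrite /= /seq_pair; case: ifP => on.
  by exists k; split=> [|i ik]; rewrite associate_cons on //; exact: ek0.
by exists j; split=> [|i ij]; rewrite associate_cons on //; exact: dj0.
Qed.

(** Given a finite prefix of x, the associate d determines a finite initial
    segment of y = d * x, and e is consulted on that segment. The segment grows
    beyond any bound with the prefix of x, since finitely many values of y depend
    on finitely many values of x. *)
Lemma realizable_composite (R S : baire -> baire -> Prop) :
  realizable R -> realizable S -> realizable (comp_rel R S).
Proof.
move=> [d Ed dR] [e Ee eS].
(* val c i is 0, or the successor of the value at i of the intermediate y *)
pose val c i := answer d i (cnth c) (csize c).
pose body n c := answer e n (fun i => (val c i).-1)
  (known (fun i => val c i != 0) (csize c)).
exists (associate body).
  move: Ed Ee; rewrite /= /associate /body /answer /val => Ed Ee /=.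
  by rewrite /answer /=; primrec hE.
move=> x z [y /dR xy /eS yz].
have val_x k i : val (code_seq (mkseq x k)) i = answer d i x k.
  rewrite /val csize_mkseq; apply: eq_answer => j jk; exact: cnth_mkseq.
have bodyE n k : exists2 N, body n (code_seq (mkseq x k)) = answer e n y N &
    forall M, M <= k -> (forall i, i < M -> answer d i x k <> 0) -> M <= N.
  exists (known (fun i => val (code_seq (mkseq x k)) i != 0) k).
    rewrite /body csize_mkseq; apply: eq_answer => i /knownP.
    by rewrite val_x => /eqP /(answer_val xy) ->.
  move=> M Mk dM; apply: leq_known => // i iM.
  by apply/eqP; rewrite val_x; exact: dM.
apply: associate_app => n.
  by move=> k; have [N -> _] := bodyE n k; exact: answer_val.
have [M MP] := answer_def n yz.
have [k kP] : exists k, forall l i, k <= l -> i < M -> answer d i x l <> 0.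
  elim: (M) => [|M' [k kP]]; first by exists 0.
  have [k' k'P] := answer_def M' xy; exists (maxn k k') => l i.
  rewrite geq_max => /andP[kl k'l].
  rewrite ltnS leq_eqVlt => /predU1P[->|iM]; first by rewrite k'P.
  exact: kP.
exists (maxn k M); have [N -> NM] := bodyE n (maxn k M).
rewrite MP //; apply: NM; first exact: leq_maxr.
by move=> i iM; apply: kP => //; exact: leq_maxl.
Qed.

(** To compute x * y from a prefix of <x, y>, consult as many of the entries of x
    at n followed by prefixes of y as are contained in that prefix. An entry of x
    that is not yet visible must stop the search, as it may be nonzero. *)
Lemma realizable_application : realizable (@app_rel baire).
Proof.
pose idx n c j := code_seq (n :: mkseq (fun i => cnth c i.*2.+1) j).
pose body n c := search (fun j => cnth c (idx n c j).*2)
  (known (fun j => (idx n c j).*2.+1 <= csize c) (csize c)./2).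
exists (associate body).
  by rewrite /= /associate /body /idx /=; primrec hE.
move=> p z [x [y [-> xy]]].
have idxE n k j : j <= k./2 ->
    idx n (code_seq (mkseq (seq_pair x y) k)) j = code_seq (n :: mkseq y j).
  move=> jk; congr (code_seq (n :: _)).
  apply/eq_in_map => i; rewrite mem_iota add0n => /andP[_ ij].
  by rewrite cnth_mkseq ?seq_pair_odd //; lia.
have bodyE n k : exists2 N, body n (code_seq (mkseq (seq_pair x y) k))
      = answer x n y N &
    forall M, M <= k./2 ->
      (forall j, j < M -> (code_seq (n :: mkseq y j)).*2 < k) -> M <= N.
  rewrite /body csize_mkseq; set N := known _ _; exists N.
    apply: eq_search => j jN; have := knownP jN.
    have jk : j <= k./2 by apply: ltnW; apply: leq_trans jN (known_leq _ _).
    by rewrite /= idxE // => ?; rewrite cnth_mkseq // seq_pair_even.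
  by move=> M Mk MP; apply: leq_known => // j jM; rewrite idxE ?MP //; lia.
apply: associate_app => n.
  by move=> k; have [N -> _] := bodyE n k; exact: answer_val.
have [M MP] := answer_def n xy.
(* long enough for the first M prefixes of y and the entries of x at them *)
pose k := M.*2 + \sum_(j < M) (code_seq (n :: mkseq y j)).*2.+1.
exists k; have [N -> NM] := bodyE n k.
rewrite MP //; apply: NM => [|j jM]; first by rewrite /k; lia.
rewrite /k (bigD1 (Ordinal jM)) //=; lia.
Qed.

(** On a sequence of length k, the associate b x simulates e on the pair of x
    with that sequence, of which the first 2k entries are determined. Each value
    of b x depends on finitely many entries of x, so b is itself continuous, with
    an associate primitive recursive in e. *)
Lemma realizable_currying (R : baire -> baire -> Prop) : realizable R ->
  exists b : baire -> baire, realizable (fun x y : baire => y = b x) /\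
    forall x y z : baire, R (cpair x y) z -> app (b x) y z.
Proof.
move=> [e Ee eR].
pose body x n c := answer e n (seq_pair x (cnth c)) (csize c).*2.
have body_ext x x' n c : (forall i, i < csize c -> x i = x' i) ->
    body x n c = body x' n c.
  move=> xx'; apply: eq_answer => i ic; rewrite /seq_pair.
  by case: odd => //; apply: xx'; lia.
exists (fun x => associate (body x)); split.
  pose code m c := let d := nsnd m.-1 in
    if csize d <= csize c then (body (cnth c) (nfst m.-1) d).+1 else 0.
  exists (associate code).
    move: Ee; rewrite /= /associate /code /body /answer /seq_pair => Ee /=.
    by primrec hE.
  move=> x _ ->; apply: associate_app => m.
    move=> k; rewrite /code csize_mkseq; case: ifP => // sk _; congr _.+1.
    apply: body_ext => i im; apply: cnth_mkseq; exact: leq_trans sk.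
  by exists (csize (nsnd m.-1)); rewrite /code csize_mkseq leqnn.
move=> x y z /eR xyz.
have bodyE n k :
    body x n (code_seq (mkseq y k)) = answer e n (seq_pair x y) k.*2.
  rewrite /body csize_mkseq; apply: eq_answer => i ik; rewrite /seq_pair.
  by case: odd => //; apply: cnth_mkseq; lia.
apply: associate_app => n.
  by move=> k; rewrite bodyE; exact: answer_val.
have [k kP] := answer_def n xyz; exists k.
by rewrite bodyE kP //; lia.
Qed.

Lemma effective_baire : effective_combinators baire.
Proof.
split.
- have := realizable_reindex (pr_id hE); congr realizable.
  by apply/funext => x; apply/funext => y; apply/propext; split.
- have Er : E (fun n => n.*2) by primrec hE.
  have [e Ee eP] := realizable_reindex Er; exists e => // p x [y ->].
  by apply: eP; apply: funext => n /=; rewrite seq_pair_even.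
- have Er : E (fun n => n.*2.+1) by primrec hE.
  have [e Ee eP] := realizable_reindex Er; exists e => // p y [x ->].
  by apply: eP; apply: funext => n /=; rewrite seq_pair_odd.
- exact: realizable_seq_pair.
- exact: realizable_composite.
- exact: realizable_application.
- exact: realizable_currying.
Qed.

End Baire.

Theorem corollary2p12 (A : appStruct)
    (hA : [\/ A = kleene1, A = kleene2 | A = kleene_vesley]) :
  order_isomorphic
    (@m_degree_le A (@computably_transparent A))
    (@W_degree_le A (@nonempty_dom A))
  /\
  order_isomorphic
    (@m_degree_le A (@transparency_law A))
    (@W_degree_le A setT).
Proof.
apply: transparent_degrees_isomorphic; case: hA => ->.
- exact: effective_kleene1.
- exact: (effective_baire primrec_closed_setT).
- exact: (effective_baire primrec_closed_computable).
Qed.
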